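(* It is false that $s(p^r)=r$ for every odd prime $p$ and every integer $r\ge1$. The smallest odd prime power $p^r$ ($p$ an odd prime, $r\ge1$) for which $s(p^r)\neq r$ is $5^5=3125$, and $s(5^5)=4$. That is: $s(5^5)=4$, and $s(p^r)=r$ for every odd prime $p$ and every integer $r\ge1$ with $p^r<5^5$.
   Context: For $n\ge 0$, $E_n$ denotes the $n$-th Euler up/down (zig-zag) number, i.e. the number of alternating permutations of $\{1,\dots,n\}$; equivalently, the $E_n$ are the integers determined by $\sum_{n\ge0}E_n z^n/n!=\sec z+\tan z$ (so $E_0=E_1=E_2=1$, $E_3=2$, $E_4=5$, $E_5=16$, $E_6=61$). A positive integer $P$ is an eventual period of a sequence $(a_n)_{n\ge0}$ if there is $t\ge0$ with $a_{n+P}=a_n$ for all $n\ge t$. For every integer $q\ge1$ the sequence $(E_n\bmod q)_{n\ge0}$ has an eventual period. Its preperiod $s(q)$ is the least integer $t\ge0$ such that $E_{n+P}\equiv E_n\pmod q$ for all $n\ge t$, where $P$ is an eventual period of the sequence (the value does not depend on the choice of $P$; one may take $P$ to be the minimal eventual period). *)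

(* Defs.v *)
From mathcomp Require Import all_boot all_fingroup.
From mathcomp Require Import boolp classical_sets.

Set Implicit Arguments.
Unset Strict Implicit.
Unset Printing Implicit Defensive.

(* Up-down permutations: s 0 < s 1 > s 2 < ...  (0-based positions and
   values). *)
Definition alternating (n : nat) (s : 'S_n) : bool :=
  [forall i : 'I_n, forall j : 'I_n,
    (j == i.+1 :> nat) ==> (if odd i then s j < s i else s i < s j)].

Definition euler_zigzag (n : nat) : nat := #|[set s : 'S_n | alternating s]|.

Definition periodic_from (T : Type) (a : nat -> T) (P t : nat) : Prop :=
  forall n, t <= n -> a (n + P) = a n.

Definition eventual_period (T : Type) (a : nat -> T) (P : nat) : Prop :=
  0 < P /\ exists t, periodic_from a P t.

Definition is_preperiod (T : Type) (a : nat -> T) (t : nat) : Prop :=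
  exists P, [/\ eventual_period a P, periodic_from a P t
    & forall t', periodic_from a P t' -> t <= t'].

(* The value is 0 by convention when [a] is not eventually periodic. *)
Definition preperiod (T : Type) (a : nat -> T) : nat :=
  xget 0 [set t | is_preperiod a t]%classic.

Definition euler_preperiod (q : nat) : nat :=
  preperiod (fun n => euler_zigzag n %% q).

Lemma periodic_fromM (T : Type) (a : nat -> T) (P t k : nat) :
  periodic_from a P t -> periodic_from a (k * P) t.
Proof.
move=> aP; elim: k => [|k IHk] n tn; first by rewrite mul0n addn0.
by rewrite mulSn addnCA addnC aP ?IHk // (leq_trans tn) ?leq_addr.
Qed.

Lemma periodic_from_indep (T : Type) (a : nat -> T) (P Q t : nat) :
  eventual_period a P -> eventual_period a Q ->
  periodic_from a P t -> periodic_from a Q t.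
Proof.
move=> [P0 _] [_ [u aQ]] aP n tn.
have uk : u <= n + u * P by rewrite (leq_trans (leq_pmulr u P0)) ?leq_addl.
rewrite -(periodic_fromM u aP (leq_trans tn (leq_addr Q n))) addnAC aQ //.
exact: (periodic_fromM u aP tn).
Qed.

Lemma is_preperiod_uniq (T : Type) (a : nat -> T) (t u : nat) :
  is_preperiod a t -> is_preperiod a u -> t = u.
Proof.
move=> [P [eP aP minP]] [Q [eQ aQ minQ]]; apply/eqP; rewrite eqn_leq.
apply/andP; split; first by apply: minP; exact: periodic_from_indep aQ.
by apply: minQ; exact: periodic_from_indep aP.
Qed.

Lemma preperiodP (T : Type) (a : nat -> T) (P : nat) :
  eventual_period a P -> is_preperiod a (preperiod a).
Proof.
move=> eP; have [_ [t0 at0]] := eP.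
have ex : exists t, `[< periodic_from a P t >] by exists t0; apply/asboolP.
case: (ex_minnP ex) => t /asboolP at_ mint.
apply: (@xgetPex _ 0 [set t | is_preperiod a t]%classic).
by exists t, P; split=> // t' /asboolP /mint.
Qed.

(* Main.v *)
Require Import Defs.
From mathcomp Require Import all_boot all_fingroup all_algebra cyclic zify ring.

Set Implicit Arguments.
Unset Strict Implicit.
Unset Printing Implicit Defensive.

(** Write [E n] for [euler_zigzag n] and [c k] for the real part of the k-th
power of the imaginary unit, so that [c] runs through 1, 0, -1, 0.  The
generating function of [E], namely sec + tan, multiplied by cos equals
1 + sin, which is the recurrence [euler_zigzag_rec]:
the sum over k of binomial(n,k) * c(k) * E(n-k) is [n = 0] - c(n+1).
It is obtained here by counting.  A permutation made of an increasing run
followed by an alternating rest either continues or breaks its run at the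
junction; the binomial coefficient counts both kinds together, and as the run
grows by two entries the second kind of one step is the first kind of another,
so the alternating sum telescopes ([pattern_total_run],
[euler_zigzag_partial]).

For M odd, the sum A_M(n) of c(n+1-j) * j^n over j < 2M satisfies the same
recurrence modulo M, because the even binomial terms add up to half of
(j+1)^n + (j-1)^n and the sum over j then collapses to its ends.  Hence
E(n) = A_M(n) modulo M ([euler_zigzag_cos_power_sum]).

Take M = p^(r+1), and let P be a multiple of 4 and of phi(p^r) with P >= r.
Passing from n to n + P leaves c alone, multiplies j^n by 1 modulo p^r if p
does not divide j, and kills j^n if p divides j.  The terms j = p*m that are
lost add up to p^n times the sum of c(n+1-pm) * m^n over m < 2p^r, and as p
is odd that sum is, up to a sign, A_(p^r)(n), hence E(n) modulo p.  So
E(n+P) = E(n) - (+/-) p^n * A_(p^r)(n) modulo p^r ([euler_zigzag_shift]).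
Two consequences determine the preperiod: the congruence modulo p^r holds for
n >= r, and for n < r the congruence modulo p^(n+1) holds exactly when p
divides E(n) ([euler_zigzag_period_defect]).  Therefore s(p^r) = r whenever p
does not divide E(r-1), while p dividing E(r-1) but not E(r-2) gives
s(p^r) = r-1.

The values 1, 1, 1, 2, 5, 16, 61 finish the proof: the only odd primes that
occur in them are 5, in E(4), and 61, in E(6).  The first gives 5^5, with
s(5^5) = 4 since E(3) = 2; the second gives 61^7, far beyond the bound. *)

(** * Permutations with a prescribed ascent pattern *)

(** [pattern_count w k] is meant to count the permutations of
[size w + 1] values with first value [k], whose i-th step is an ascent exactly
when the i-th entry of [w] is true.  Removing the first value and closing the
gap turns a second value above [k] into some [j >= k]; hence the non-strict
comparison. *)
Fixpoint pattern_count (w : seq bool) (k : nat) : nat :=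
  if w is b :: w' then
    sumn [seq pattern_count w' j | j <- iota 0 (size w').+1 & (k <= j) == b]
  else k == 0.

Lemma pattern_count_cons b w k :
  pattern_count (b :: w) k =
  \sum_(0 <= j < (size w).+1 | (k <= j) == b) pattern_count w j.
Proof. by rewrite /= sumnE big_map -[RHS]big_filter /index_iota subn0. Qed.

Definition has_pattern n (d : nat -> bool) (s : 'S_n.+1) : bool :=
  [forall i : 'I_n, (s (widen_ord (leqnSn n) i) < s (lift ord0 i)) == d i].

(** A permutation is determined by its first value and by the relative order of
the other values. *)
Lemma lift_perm_bij n :
  bijective (fun p : 'I_n.+1 * 'S_n => lift_perm ord0 p.1 p.2).
Proof.
apply: inj_card_bij; last by rewrite card_prod card_ord !card_Sn factS.
move=> [j s] [k t] /= eq_st.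
have jk : j = k by rewrite -(lift_perm_id ord0 j s) eq_st lift_perm_id.
rewrite jk in eq_st *; congr (_, _); apply/permP => i.
by apply: (@lift_inj _ k); rewrite -!(lift_perm_lift ord0) eq_st.
Qed.

(** Inserting [k] as a first value shifts the values from [k] on by one, an
increasing map, so only the first step of the pattern is new. *)
Lemma has_pattern_lift n d (k : 'I_n.+2) (t : 'S_n.+1) :
  has_pattern d (lift_perm ord0 k t) =
  ((k <= t ord0) == d 0) && has_pattern (fun i => d i.+1) t.
Proof.
have ltE (a : 'I_n.+2) (b c : 'I_n.+1) : (lift a b < lift a c) = (b < c).
  by rewrite /= /bump; lia.
apply/forallP/andP => [dP|[d0 /forallP dP] i].
  split.
    have := dP ord0; rewrite lift_perm_lift.
    have -> : widen_ord (leqnSn n.+1) ord0 = ord0 by apply/val_inj.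
    by rewrite lift_perm_id /= /bump; move=> /eqP <-; apply/eqP; lia.
  apply/forallP => i; have := dP (lift ord0 i); rewrite lift_perm_lift.
  have -> : widen_ord (leqnSn n.+1) (lift ord0 i)
          = lift ord0 (widen_ord (leqnSn n) i) by apply/val_inj.
  by rewrite lift_perm_lift ltE.
rewrite lift_perm_lift; case: (unliftP ord0 i) => [j|] ->.
  have -> : widen_ord (leqnSn n.+1) (lift ord0 j)
          = lift ord0 (widen_ord (leqnSn n) j) by apply/val_inj.
  by rewrite lift_perm_lift ltE; apply: dP.
have -> : widen_ord (leqnSn n.+1) ord0 = ord0 by apply/val_inj.
by rewrite lift_perm_id /= /bump -(eqP d0); apply/eqP; lia.
Qed.

Lemma card_has_pattern n d (k : 'I_n.+1) :
  #|[set s : 'S_n.+1 | has_pattern d s & s ord0 == k]|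
  = pattern_count (mkseq d n) k.
Proof.
elim: n d k => [|n IHn] d k.
  rewrite [k]ord1 -[RHS](card_Sn 1) -cardsT; apply: eq_card => s.
  by rewrite !inE [s ord0]ord1 eqxx andbT; apply/forallP; case.
have -> : mkseq d n.+1 = d 0 :: mkseq (fun i => d i.+1) n.
  by rewrite /mkseq /= -[1]/(1 + 0) iotaDl -map_comp.
rewrite pattern_count_cons size_mkseq -sum1_card.
rewrite (reindex _ (onW_bij _ (lift_perm_bij n.+1))).
under eq_bigl => p do rewrite inE has_pattern_lift lift_perm_id.
transitivity (\sum_(p : 'I_n.+2 * 'S_n.+1 | (p.1 == k) &&
   (((k <= p.2 ord0) == d 0) && has_pattern (fun i => d i.+1) p.2)) 1).
  apply: eq_bigl => -[j t] /=; rewrite andbC.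
  by case: eqP => // ->.
rewrite -(pair_big_dep (pred1 k) (fun _ (t : 'S_n.+1) =>
  ((k <= t ord0) == d 0) && has_pattern (fun i => d i.+1) t)
  (fun _ _ => 1)) big_pred1_eq.
rewrite (partition_big (fun t : 'S_n.+1 => t ord0)
  (fun j : 'I_n.+1 => (k <= j) == d 0)) /=; last by move=> t /andP[].
rewrite big_mkord; apply: eq_bigr => j kj.
rewrite -IHn -sum1_card; apply: eq_bigl => t.
by rewrite inE; case: (t ord0 =P j) => [->|_]; rewrite ?andbF // kj.
Qed.

Fixpoint zigzag (b : bool) (n : nat) : seq bool :=
  if n is m.+1 then b :: zigzag (~~ b) m else [::].

Lemma size_zigzag b n : size (zigzag b n) = n.
Proof. by elim: n b => //= n IHn b; rewrite IHn. Qed.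

Lemma mkseq_zigzag b n : mkseq (fun i => odd i (+) b) n = zigzag b n.
Proof.
elim: n b => //= n IHn b; rewrite -IHn /mkseq /= -[1]/(1 + 0) iotaDl -map_comp.
by congr (_ :: _); apply: eq_map => i /=; rewrite addNb addbN.
Qed.

Lemma has_pattern_alternating n (s : 'S_n.+1) :
  alternating s = has_pattern (fun i => odd i (+) true) s.
Proof.
apply/forallP/forallP => [alt i|alt i].
  have /forallP/(_ (lift ord0 i)) := alt (widen_ord (leqnSn n) i).
  rewrite /= eqxx /= addbT.
  set a := s _; set b := s _.
  have : a != b.
    by rewrite (inj_eq perm_inj) -val_eqE /= /bump; lia.
  rewrite -val_eqE /=; case: (odd i) => /=; lia.
apply/forallP => j; apply/implyP => /eqP ji.
have ilt : i < n by have := ltn_ord j; rewrite ji.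
have := alt (Ordinal ilt).
have -> : widen_ord (leqnSn n) (Ordinal ilt) = i by apply/val_inj.
have -> : lift ord0 (Ordinal ilt) = j by apply/val_inj.
have : s i != s j by rewrite (inj_eq perm_inj) -val_eqE /= ji; lia.
rewrite /= addbT -val_eqE /=; case: (odd i) => /=; lia.
Qed.

(** The number of permutations with pattern [w]: putting the smallest value in
front of each of them loses nothing. *)
Definition pattern_total (w : seq bool) : nat := pattern_count (true :: w) 0.

Lemma euler_zigzagS n : euler_zigzag n.+1 = pattern_total (zigzag true n).
Proof.
rewrite /pattern_total pattern_count_cons size_zigzag /= big_mkord.
rewrite /euler_zigzag -sum1_card.
rewrite (partition_big (fun t : 'S_n.+1 => t ord0) predT) //=.
apply: eq_bigr => k _; rewrite -mkseq_zigzag -card_has_pattern -sum1_card.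
by apply: eq_bigl => s; rewrite !inE has_pattern_alternating.
Qed.

Lemma euler_zigzag0 : euler_zigzag 0 = 1.
Proof.
rewrite /euler_zigzag -[RHS](card_Sn 0) -cardsT; apply: eq_card => s.
by rewrite !inE; apply/forallP; case.
Qed.

(** * The recurrence from sec + tan *)

Lemma sum_bin_diag m n : \sum_(0 <= j < n) 'C(j, m) = 'C(n, m.+1).
Proof.
elim: n => [|n IHn]; first by rewrite big_geq.
by rewrite big_nat_recr //= IHn binS addnC.
Qed.

(** When the step after the run is left free, the run and [w] become
independent: the values above [k] that complete the run are chosen freely,
and [w] is realised on the remaining values. *)
Lemma pattern_count_run m w k : k <= (size w + m).+1 ->
  pattern_count (nseq m true ++ true :: w) k
  + pattern_count (nseq m true ++ false :: w) k
  = 'C((size w + m).+1 - k, m) * pattern_total w.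
Proof.
elim: m k => [|m IHm] k kle.
  rewrite bin0 mul1n /pattern_total !cat0s !pattern_count_cons.
  rewrite [RHS](bigID (fun j => k <= j)) /=.
  by congr (_ + _); apply: eq_bigl => j; case: (k <= j).
rewrite -[LHS]/(pattern_count (true :: (nseq m true ++ true :: w)) k
   + pattern_count (true :: (nseq m true ++ false :: w)) k).
rewrite !pattern_count_cons !size_cat !size_nseq /= -big_split /=.
transitivity (\sum_(0 <= j < (size w + m.+1).+1 | k <= j)
     'C((size w + m).+1 - j, m) * pattern_total w).
  rewrite [m + _]addnC !addnS !addSn.
  rewrite [LHS]big_nat_cond [RHS]big_nat_cond.
  apply: eq_big => [j|j /andP[/andP[_ jlt] _]]; first by rewrite eqb_id.
  by rewrite IHm.
rewrite -big_distrl /=; congr (_ * _).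
rewrite -(big_nat_widenl k 0 _ predT) // -sum_bin_diag.
rewrite -{1}[k]add0n big_addn.
rewrite [RHS]big_nat_rev /= !big_nat; apply: eq_bigr => j jlt.
congr 'C(_, _); lia.
Qed.

Lemma pattern_total_run m w :
  pattern_total (nseq m true ++ true :: w)
  + pattern_total (nseq m true ++ false :: w)
  = 'C((size w + m).+2, m.+1) * pattern_total w.
Proof.
have := @pattern_count_run m.+1 w 0 isT.
by rewrite subn0 addnS.
Qed.

Lemma pattern_count_nseq n k : pattern_count (nseq n true) k = (k == 0).
Proof.
elim: n k => // n IHn k; rewrite pattern_count_cons size_nseq.
under eq_bigr do rewrite IHn.
rewrite big_mkcond big_nat_recl //= big1 ?addn0; last by move=> j _; case: ifP.
by case: k.
Qed.

Lemma pattern_total_nseq n : pattern_total (nseq n true) = 1.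
Proof. exact: (pattern_count_nseq n.+1 0). Qed.

Import GRing.Theory.

(** The real part of the [k]-th power of the imaginary unit, or
cos(k * pi / 2). *)
Definition cos_quarter (k : nat) : int :=
  if odd k then 0%R else ((-1) ^+ k./2)%R.

Lemma cos_quarterD2 k m :
  cos_quarter (k + 2 * m) = ((-1) ^+ m * cos_quarter k)%R.
Proof.
rewrite /cos_quarter oddD mul2n odd_double addbF halfD.
rewrite odd_double andbF add0n doubleK.
by case: odd; rewrite ?mulr0 // ?addnA exprD mulrC.
Qed.

Lemma cos_quarterD4 k m : cos_quarter (k + 4 * m) = cos_quarter k.
Proof. by rewrite -(mulnA 2 2) cos_quarterD2 mulnC exprM sqrr_sign mul1r. Qed.

Lemma cos_quarterM k l :
  (cos_quarter k * cos_quarter l)%R =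
  if odd k then 0%R else cos_quarter (k + l).
Proof.
rewrite /cos_quarter oddD; case ok: (odd k); first by rewrite mul0r.
by case: (odd l); rewrite ?mulr0 //= halfD ok add0n exprD.
Qed.

Lemma cos_quarter_sign k : (cos_quarter k * (-1) ^+ k)%R = cos_quarter k.
Proof.
by rewrite /cos_quarter -(signr_odd _ k); case: (odd k); rewrite ?mul0r ?mulr1.
Qed.

Local Open Scope ring_scope.

(** The term of index k = 2(i+1) counts the permutations with a run of 2(i+1)
ascending entries before an alternating rest.  If the step after the run is a
descent, the last ascent of the run can be moved to the alternating part, which
cancels the previous partial sum; if it is an ascent, one gets the new partial sum. *)
Lemma euler_zigzag_partial n i : (2 * i <= n)%N ->
  \sum_(k < (2 * i).+1) 'C(n.+1, k)%:Z * cos_quarter k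
      * (euler_zigzag (n.+1 - k))%:Z
  = (-1) ^+ i
    * (pattern_total (nseq (2 * i) true ++ zigzag true (n - 2 * i)))%:Z.
Proof.
elim: i => [|i IHi] lein.
  rewrite muln0 big_ord_recr big_ord0 /= bin0 expr0 !mul1r add0r !subn0.
  by rewrite euler_zigzagS.
have lin : (2 * i <= n)%N by lia.
rewrite mulnS !addSn add0n.
rewrite big_ord_recr big_ord_recr /= IHi //.
rewrite [cos_quarter (2 * i).+1]/cos_quarter /= oddM /= mulr0 mul0r addr0.
rewrite -[(2 * i).+2]/(2 + 2 * i)%N cos_quarterD2.
have -> : (n.+1 - (2 + 2 * i) = (n - (2 + 2 * i)).+1)%N by lia.
set m := (n - (2 + 2 * i))%N; rewrite euler_zigzagS.
have -> : (n - 2 * i)%N = m.+2 by rewrite /m; lia.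
have := pattern_total_run (2 * i).+1 (zigzag true m).
rewrite size_zigzag.
have -> : (m + (2 * i).+1).+2 = n.+1 by rewrite /m; lia.
have runS (b : bool) w : nseq (2 * i).+1 true ++ b :: w =
    nseq (2 * i) true ++ true :: b :: w by elim: (2 * i)%N => //= ? ->.
have -> : nseq (2 * i).+1 true ++ true :: zigzag true m
    = nseq (2 + 2 * i) true ++ zigzag true m.
  by rewrite runS; elim: (2 * i)%N => //= ? [->].
rewrite runS -[true :: false :: zigzag true m]/(zigzag true m.+2).
move=> /(congr1 Posz); rewrite PoszD PoszM => eq_tot.
rewrite mulrAC -eq_tot exprS [cos_quarter 2]/cos_quarter /= expr1; ring.
Qed.

Lemma euler_zigzag_rec n :
  \sum_(k < n.+1) 'C(n, k)%:Z * cos_quarter k * (euler_zigzag (n - k))%:Z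
  = (n == 0)%:Z - cos_quarter n.+1.
Proof.
case: n => [|n]; first by rewrite big_ord_recr big_ord0 /= euler_zigzag0.
have [i ni] : exists i, n = (odd n + 2 * i)%N.
  by exists n./2; rewrite mul2n odd_double_half.
rewrite sub0r; case: (odd n) ni => ->; last first.
  rewrite add0n big_ord_recr /= euler_zigzag_partial // subnn cats0.
  rewrite pattern_total_nseq mulr1 {1}/cos_quarter /= oddM /= mulr0 mul0r addr0.
  rewrite -[(2 * i).+2]/(2 + 2 * i)%N cos_quarterD2 /cos_quarter /= expr1.
  by rewrite mulrN1 opprK.
rewrite add1n 2!big_ord_recr /= euler_zigzag_partial ?leqnSn //.
rewrite subSnn -[zigzag true 1]/(nseq 1 true) -nseqD pattern_total_nseq mulr1.
rewrite {1}/cos_quarter /= oddM /= mulr0 mul0r addr0.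
rewrite binn subnn euler_zigzag0 mul1r mulr1.
rewrite -[(2 * i).+2]/(2 + 2 * i)%N cos_quarterD2 {1}/cos_quarter /= expr1.
rewrite mulrN1 subrr.
by rewrite /cos_quarter /= oddM oppr0.
Qed.

(** * The recurrence modulo an odd number *)

(** The argument of [cos_quarter] stands for [n + 1 - j]: it only matters
modulo 4, and [3 * j] avoids the truncated subtraction. *)
Definition cos_power_sum (M n : nat) : int :=
  \sum_(j < 2 * M) cos_quarter (n.+1 + 3 * j) * j%:Z ^+ n.

Lemma binomial_even_terms n (x : int) :
  (\sum_(k < n.+1 | ~~ odd k) 'C(n, k)%:Z * x ^+ (n - k)) *+ 2
  = (x + 1) ^+ n + (x - 1) ^+ n.
Proof.
rewrite !exprDn -big_split -sumrMnl [RHS](bigID (fun k : 'I_n.+1 => odd k)) /=.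
rewrite [X in _ = X + _]big1 ?add0r => [|k ok].
  apply: eq_bigr => k ek; rewrite expr1n mulr1 -signr_odd (negbTE ek) mulr1.
  by rewrite -mulr_natl mulr2n natz.
by rewrite expr1n -signr_odd ok mulr1 mulrN1 mulNrn subrr.
Qed.

(** The product of [cos_quarter k] and [cos_quarter l] is
[cos_quarter (k + l)] or 0 according to the parity of [k], so the
convolution acts on each power of [j] separately. *)
Lemma cos_power_sum_conv M n :
  \sum_(k < n.+1) 'C(n, k)%:Z * cos_quarter k * cos_power_sum M (n - k)
  = \sum_(j < 2 * M) cos_quarter (n.+1 + 3 * j) *
      (\sum_(k < n.+1 | ~~ odd k) 'C(n, k)%:Z * j%:Z ^+ (n - k)).
Proof.
under [LHS]eq_bigr do rewrite mulr_sumr.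
rewrite exchange_big; apply: eq_bigr => j _.
rewrite mulr_sumr [RHS]big_mkcond; apply: eq_bigr => k _ /=.
have kn := ltn_ord k.
rewrite mulrA -(mulrA _ (cos_quarter k)) cos_quarterM.
have -> : (k + ((n - k).+1 + 3 * j) = n.+1 + 3 * j)%N by lia.
by case: (odd k); rewrite /= ?mulr0 ?mul0r // [_ * cos_quarter _]mulrC mulrA.
Qed.

(** With t(j) = cos_quarter (n + 2 - j) * j^n, the summand is t(j+1) - t(j-1),
and the sum telescopes to its four boundary terms. *)
Lemma cos_power_sum_shift N n :
  \sum_(j < N.+1) cos_quarter (n.+1 + 3 * j)
      * ((j%:Z + 1) ^+ n + (j%:Z - 1) ^+ n)
  = cos_quarter (n.+2 + 3 * N.+1) * N.+1%:Z ^+ n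
    + cos_quarter (n.+2 + 3 * N) * N%:Z ^+ n
    + cos_quarter n * 0 ^+ n - cos_quarter n.+1.
Proof.
elim: N => [|N IHN].
  rewrite big_ord_recr big_ord0 /= muln0 !addn0 muln1 -[Posz 0]/(0 : int).
  rewrite !add0r.
  have -> : (n.+2 + 3 = n.+1 + 4 * 1)%N by lia.
  have -> : n.+2 = (n + 2 * 1)%N by lia.
  rewrite cos_quarterD4 cos_quarterD2 expr1 mulN1r !mulrDr.
  have -> : cos_quarter n.+1 * (-1) ^+ n = - cos_quarter n.+1.
    by rewrite -[in RHS](cos_quarter_sign n.+1) exprS; ring.
  ring.
rewrite big_ord_recr /= {}IHN.
have -> : (n.+2 + 3 * N.+2 = n.+1 + 3 * N.+1 + 4 * 1)%N by lia.
have -> : (n.+2 + 3 * N.+1 = n.+1 + 3 * N.+1 + 1)%N by lia.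
rewrite cos_quarterD4.
have -> : cos_quarter (n.+1 + 3 * N.+1) = - cos_quarter (n.+2 + 3 * N).
  rewrite -mulN1r -[-1]expr1 -cos_quarterD2; congr cos_quarter; lia.
have -> : N.+1%:Z - 1 = N%:Z by rewrite -addn1 PoszD addrK.
have -> : N.+1%:Z + 1 = N.+2%:Z by rewrite -PoszD addn1.
ring.
Qed.

Lemma dvdz_exp_sub (d a b : int) n : (d %| a - b)%Z -> (d %| a ^+ n - b ^+ n)%Z.
Proof. by move=> dab; rewrite subrXX dvdz_mulr. Qed.

(** Modulo [M] the upper boundary 2M, 2M - 1 looks like 0, -1; since 2M is 2
modulo 4, the upper boundary terms equal the lower ones instead of cancelling
them.  This doubles the expected value, in accordance with the factor 2 of
[binomial_even_terms], which is invertible modulo [M]. *)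
Lemma cos_power_sum_rec M n : odd M ->
  (M %| \sum_(k < n.+1) 'C(n, k)%:Z * cos_quarter k * cos_power_sum M (n - k)
        - ((n == 0%N)%:Z - cos_quarter n.+1))%Z.
Proof.
move=> oM; have M2 : coprimez M 2 by rewrite coprimezE coprimen2.
have M0 : (0 < 2 * M)%N by rewrite muln_gt0 (odd_gt0 oM).
rewrite -(Gauss_dvdzr _ M2) mulrBr -mulr_natl; set S := \sum_(_ < _) _.
have -> : 2 * S = \sum_(j < (2 * M).-1.+1) cos_quarter (n.+1 + 3 * j) *
     ((j%:Z + 1) ^+ n + (j%:Z - 1) ^+ n).
  rewrite prednK // /S cos_power_sum_conv mulr_sumr.
  by apply: eq_bigr => j _; rewrite -binomial_even_terms; ring.
rewrite cos_power_sum_shift prednK //.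
have -> : cos_quarter (n.+2 + 3 * (2 * M)) = cos_quarter n.
  have -> : (n.+2 + 3 * (2 * M) = n + 4 * (2 + 3 * M./2))%N.
    by have := odd_double_half M; rewrite oM; lia.
  by rewrite cos_quarterD4.
have -> : cos_quarter (n.+2 + 3 * (2 * M).-1) = cos_quarter n.+1.
  have -> : (n.+2 + 3 * (2 * M).-1 = n.+1 + 4 * (1 + 3 * M./2))%N.
    by have := odd_double_half M; rewrite oM; lia.
  by rewrite cos_quarterD4.
have c0 : cos_quarter n * 0 ^+ n = (n == 0%N)%:Z.
  by rewrite expr0n; case: (n) => // m; rewrite mulr0.
have c1 : cos_quarter n.+1 * (-1) ^+ n = - cos_quarter n.+1.
  by rewrite -[in RHS](cos_quarter_sign n.+1) exprS; ring.
set a := (_%:Z); set b := (_.-1%:Z).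
have -> : cos_quarter n * a ^+ n + cos_quarter n.+1 * b ^+ n
   + cos_quarter n * 0 ^+ n - cos_quarter n.+1 - 2 * ((n == 0%N)%:Z - cos_quarter n.+1)
   = cos_quarter n * (a ^+ n - 0 ^+ n)
     + cos_quarter n.+1 * (b ^+ n - (-1) ^+ n).
  by rewrite !mulrBr c1 c0; ring.
have dM : (M %| a)%Z by rewrite /a PoszM dvdz_mull.
apply: rpredD; apply: dvdz_mull; apply: dvdz_exp_sub; rewrite ?subr0 //.
have -> : b - -1 = a; last by [].
by rewrite /a /b opprK -PoszD addn1 prednK.
Qed.

(** Both sides satisfy a recurrence with the same right-hand side, in which the
term of index 0 has coefficient 1 and thus determines the value at [n]. *)
Lemma euler_zigzag_cos_power_sum M n : odd M ->
  (M %| (euler_zigzag n)%:Z - cos_power_sum M n)%Z.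
Proof.
move=> oM; elim/ltn_ind: n => n IHn.
have := cos_power_sum_rec n oM; rewrite -euler_zigzag_rec -sumrB.
rewrite big_ord_recl /= bin0 subn0 mul1r.
rewrite rpredDr; first by rewrite /cos_quarter /= !mul1r -opprB rpredN.
apply: rpred_sum => k _; rewrite -mulrBr -opprB mulrN rpredN.
by have kn := ltn_ord k; apply: dvdz_mull; apply: IHn; rewrite /bump /=; lia.
Qed.

(** * Shifting the index by a period *)

(** Write p = 2h + 1.  The extra angle contributes the sign (-1)^(h * m), and m
has the parity of n + 1 unless both sides vanish, so the sign does not depend
on [m]. *)
Lemma cos_quarter_mul_odd p n m : odd p ->
  cos_quarter (n.+1 + 3 * (m * p))
  = (-1) ^+ (p./2 * n.+1) * cos_quarter (n.+1 + 3 * m).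
Proof.
move=> op.
have -> : (n.+1 + 3 * (m * p) = n.+1 + 3 * m + 2 * (3 * (m * p./2)))%N.
  by have := odd_double_half p; rewrite op -{2}[p]/p; nia.
rewrite cos_quarterD2 -signr_odd -[in RHS]signr_odd !oddM /=.
rewrite /cos_quarter oddD oddM /=.
by case: (odd m); case: (odd p./2); case: (odd n); rewrite ?mulr0.
Qed.

Lemma PoszX (a b : nat) : (a ^ b)%N%:Z = a%:Z ^+ b.
Proof. by rewrite -!natz natrX. Qed.

(** The terms of the power sum whose base is prime to [p] are unchanged by
the shift, those with a base divisible by [p] disappear; the latter form
[p ^ n] times a power sum of the same kind. *)
Lemma euler_zigzag_shift p r n P : prime p -> odd p ->
    (4 %| P)%N -> (totient (p ^ r) %| P)%N -> (r <= P)%N ->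
  ((p ^ r)%N %| (euler_zigzag (n + P))%:Z - (euler_zigzag n)%:Z
     + p%:Z ^+ n * ((-1) ^+ (p./2 * n.+1) * cos_power_sum (p ^ r) n))%Z.
Proof.
move=> pp op P4 Pt rP.
(* One factor p more than the modulus: the multiples of p below 2M are p times
   the integers below 2q, and a sum of that length still determines the number
   modulo p when r = 1. *)
set q := (p ^ r)%N; set M := (q * p)%N.
have oM : odd M by rewrite /M /q oddM oddX op orbT.
have qM : (q%:Z %| M%:Z)%Z by rewrite PoszM dvdz_mulr.
have EM k := dvdz_trans qM (euler_zigzag_cos_power_sum k oM).
have -> : (euler_zigzag (n + P))%:Z - (euler_zigzag n)%:Z
     + p%:Z ^+ n * ((-1) ^+ (p./2 * n.+1) * cos_power_sum q n)
   = ((euler_zigzag (n + P))%:Z - cos_power_sum M (n + P))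
     - ((euler_zigzag n)%:Z - cos_power_sum M n)
     + (cos_power_sum M (n + P) - cos_power_sum M n
        + p%:Z ^+ n * ((-1) ^+ (p./2 * n.+1) * cos_power_sum q n)) by ring.
apply: rpredD; first by apply: rpredB; apply: EM.
have -> : cos_power_sum M (n + P) - cos_power_sum M n =
   \sum_(0 <= j < 2 * q * p) cos_quarter (n.+1 + 3 * j)
     * (j%:Z ^+ n * (j%:Z ^+ P - 1)).
  rewrite -mulnA big_mkord -sumrB; apply: eq_bigr => j _.
  have [h ->] := dvdnP P4.
  have -> : ((n + h * 4).+1 + 3 * j = n.+1 + 3 * j + 4 * h)%N by lia.
  by rewrite cos_quarterD4 exprD; ring.
rewrite /cos_power_sum.
rewrite -(big_mkord xpredT (fun j => cos_quarter (n.+1 + 3 * j) * j%:Z ^+ n)).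
(* Blocks of p consecutive bases, each beginning with a multiple of p. *)
rewrite big_nat_mul !mulr_sumr -big_split; apply: rpred_sum => m _ /=.
have p0 := prime_gt0 pp.
rewrite -{1}[(m * p)%N]add0n big_addn mulSn addnK.
rewrite -{1}(prednK p0) big_nat_recl //=.
rewrite add0n addrAC rpredD //.
  rewrite cos_quarter_mul_odd // PoszM [in X in X + _]exprMn.
  set c := cos_quarter _; set s := (-1) ^+ _.
  have -> : s * c * (m%:Z ^+ n * p%:Z ^+ n * ((m%:Z * p%:Z) ^+ P - 1))
     + p%:Z ^+ n * (s * (c * m%:Z ^+ n))
   = s * c * m%:Z ^+ n * p%:Z ^+ n * m%:Z ^+ P * p%:Z ^+ P
    by rewrite exprMn; ring.
  rewrite dvdz_mull // -(subnK rP) exprD dvdz_mull // /q.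
  by rewrite PoszX.
rewrite big_nat; apply: rpred_sum => j /andP[_ jp].
apply: dvdz_mull; apply: dvdz_mull.
set i := (j.+1 + m * p)%N.
have ci : coprime i q.
  rewrite coprimeXr // coprime_sym prime_coprime // /i.
  by rewrite dvdn_addl ?dvdn_mull // gtnNdvd //; lia.
rewrite -PoszX -eqz_mod_dvd.
have [h ->] := dvdnP Pt; rewrite mulnC expnM.
rewrite -[1]/(1%N : int) !modz_nat eqz_nat -modnXm.
by rewrite Euler_exp_totient // modnXm exp1n.
Qed.

Lemma eqn_mod_dvdz d a b : (a == b %[mod d])%N = (d %| a%:Z - b%:Z)%Z.
Proof. by rewrite -eqz_mod_dvd !modz_nat eqz_nat. Qed.

(** A common multiple of 4 and [totient (p ^ r)]; the factor [p ^ r] only makes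
it at least [r]. *)
Definition zigzag_period (p r : nat) : nat :=
  (4 * p ^ r * totient (p ^ r))%N.

Lemma zigzag_period_gt0 p r : prime p -> (0 < zigzag_period p r)%N.
Proof.
by move=> pp; rewrite !muln_gt0 totient_gt0 !expn_gt0 (prime_gt0 pp).
Qed.

Lemma euler_zigzag_shift_period p r n : prime p -> odd p ->
  ((p ^ r)%N %| (euler_zigzag (n + zigzag_period p r))%:Z - (euler_zigzag n)%:Z
     + p%:Z ^+ n * ((-1) ^+ (p./2 * n.+1) * cos_power_sum (p ^ r) n))%Z.
Proof.
move=> pp op; apply: euler_zigzag_shift => //.
- by rewrite /zigzag_period -mulnA dvdn_mulr.
- exact: dvdn_mull.
rewrite /zigzag_period (leq_trans (ltnW (ltn_expl r (prime_gt1 pp)))) //.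
by rewrite mulnAC leq_pmull // muln_gt0 totient_gt0 expn_gt0 (prime_gt0 pp).
Qed.

Lemma euler_zigzag_periodic p r n : prime p -> odd p -> (r <= n)%N ->
  (euler_zigzag (n + zigzag_period p r) = euler_zigzag n %[mod p ^ r])%N.
Proof.
move=> pp op rn; apply/eqP; rewrite eqn_mod_dvdz.
have := euler_zigzag_shift_period r n pp op; rewrite rpredDr //.
by rewrite dvdz_mulr // -PoszX dvdzE /= dvdn_exp2l.
Qed.

(** Modulo p^(n+1) the change is, up to sign, [p ^ n] times a number
congruent to [euler_zigzag n] modulo [p]. *)
Lemma euler_zigzag_period_defect p r n : prime p -> odd p -> (n < r)%N ->
  (euler_zigzag (n + zigzag_period p r) == euler_zigzag n %[mod p ^ n.+1])%N
  = (p %| euler_zigzag n)%N.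
Proof.
move=> pp op nr; rewrite eqn_mod_dvdz.
have oq : odd (p ^ r) by rewrite oddX op orbT.
have dE : (p %| (euler_zigzag n)%:Z - cos_power_sum (p ^ r) n)%Z.
  apply: dvdz_trans (euler_zigzag_cos_power_sum n oq).
  by rewrite dvdzE /= dvdn_exp // (leq_ltn_trans _ nr).
have dS : ((p ^ n.+1)%N %| (p ^ r)%N%:Z)%Z by rewrite dvdzE /= dvdn_exp2l.
have := dvdz_trans dS (euler_zigzag_shift_period r n pp op).
set D := (euler_zigzag (n + _))%:Z - _.
set B := p%:Z ^+ n * _ => dD.
transitivity (p %| cos_power_sum (p ^ r) n)%Z; last first.
  rewrite -[RHS]/(p %| (euler_zigzag n)%:Z)%Z.
  rewrite -[in RHS](subrK (cos_power_sum (p ^ r) n) (euler_zigzag n)%:Z).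
  by rewrite rpredDl.
transitivity ((p ^ n.+1)%N %| B)%Z.
  apply/idP/idP => dX; first by rewrite rpredDl in dD.
  by rewrite rpredDr in dD.
rewrite /B PoszX exprSr dvdz_mul2l ?expf_neq0 //; last first.
  by rewrite eqz_nat -lt0n prime_gt0.
by rewrite -signr_odd !dvdzE abszMsign.
Qed.

Local Close Scope ring_scope.

(** * Preperiods modulo powers of odd primes *)

(** A preperiod at most [n] would make the congruence modulo [p ^ r], hence
modulo p^(n+1), hold at index [n], which forces [p] to divide
[euler_zigzag n]. *)
Lemma euler_preperiod_eq p r n : prime p -> odd p -> n < r ->
    ~~ (p %| euler_zigzag n) ->
    (forall k, n < k < r ->
      euler_zigzag (k + zigzag_period p r) = euler_zigzag k %[mod p ^ r]) ->
  euler_preperiod (p ^ r) = n.+1.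
Proof.
move=> pp op nr ndvd Pn.
set a := fun n => euler_zigzag n %% p ^ r.
have perr : periodic_from a (zigzag_period p r) r.
  by move=> k rk; apply: euler_zigzag_periodic.
have per : periodic_from a (zigzag_period p r) n.+1.
  move=> k nk; have [/perr //|kr] := leqP r k.
  by apply: Pn; rewrite nk.
have evP : eventual_period a (zigzag_period p r).
  by split; [apply: zigzag_period_gt0 | exists r].
apply: (is_preperiod_uniq (preperiodP evP)).
exists (zigzag_period p r); split=> // t pert; rewrite ltnNge.
apply: contra ndvd => /pert; rewrite /a => an.
rewrite -(euler_zigzag_period_defect pp op nr).
have dvd_pow : p ^ n.+1 %| p ^ r by rewrite dvdn_exp2l.
by rewrite -(modn_dvdm (euler_zigzag n) dvd_pow) -an modn_dvdm.
Qed.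

Lemma euler_preperiod_prime_power p n : prime p -> odd p ->
  ~~ (p %| euler_zigzag n) -> euler_preperiod (p ^ n.+1) = n.+1.
Proof.
move=> pp op ndvd; apply: euler_preperiod_eq => // k /andP[nk].
by rewrite ltnS leqNgt nk.
Qed.

Lemma euler_preperiod_drop p n : prime p -> odd p ->
    ~~ (p %| euler_zigzag n) -> p %| euler_zigzag n.+1 ->
  euler_preperiod (p ^ n.+2) = n.+1.
Proof.
move=> pp op ndvd dvd; apply: euler_preperiod_eq => // k.
rewrite ltnS => nk; have -> : k = n.+1 by apply/eqP; rewrite eqn_leq andbC.
by apply/eqP; rewrite euler_zigzag_period_defect.
Qed.

Lemma euler_zigzag_values :
  [seq euler_zigzag n | n <- iota 0 7] = [:: 1; 1; 1; 2; 5; 16; 61].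
Proof. by rewrite /= euler_zigzag0 !euler_zigzagS. Qed.

(** The bound forces [n < 7], as 3^8 > 5^5; the odd primes dividing one of the
first seven values are 5, at n = 4, where p^(n+1) is exactly the excluded
5^5, and 61, at n = 6. *)
Lemma prime_ndvd_euler_zigzag p n : prime p -> odd p -> p ^ n.+1 < 5 ^ 5 ->
  ~~ (p %| euler_zigzag n).
Proof.
move=> pp op lt_pn.
have p3 : 2 < p by case: p pp op {lt_pn} => [|[|[|]]].
have [E0 E1 E2 E3 E4 E5 E6] := euler_zigzag_values.
have n7 : n < 7.
  rewrite ltnNge; apply/negP => n7; move: lt_pn; rewrite ltnNge => /negP; apply.
  apply: leq_trans (leq_pexp2l (ltnW (ltnW p3)) (n7 : 8 <= n.+1)).
  by apply: (@leq_trans (3 ^ 8)); rewrite // leq_exp2r.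
have p1 : ~~ (p %| 1) by rewrite dvdn1 neq_ltn (ltnW p3) orbT.
have p2 : ~~ (p %| 2) by rewrite gtnNdvd.
case: n n7 lt_pn => [|[|[|[|[|[|[|//]]]]]]] _;
  rewrite ?E0 ?E1 ?E2 ?E3 ?E4 ?E5 ?E6 //.
- move=> lt_p5; rewrite dvdn_prime2 //; apply: contraL lt_p5 => /eqP ->.
  by rewrite ltnn.
- by rewrite -[16]/(2 ^ 4) Euclid_dvdX // andbT.
- move=> lt_p7; rewrite dvdn_prime2 //; apply: contraL lt_p7 => /eqP ->.
  by rewrite -leqNgt.
Qed.

Theorem theorem6p4 :
  ~ (forall p r : nat, prime p -> odd p -> 1 <= r ->
       euler_preperiod (p ^ r) = r)
  /\ (euler_preperiod (5 ^ 5) <> 5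
      /\ forall p r : nat, prime p -> odd p -> 1 <= r ->
           euler_preperiod (p ^ r) <> r -> 5 ^ 5 <= p ^ r)
  /\ euler_preperiod (5 ^ 5) = 4
  /\ forall p r : nat, prime p -> odd p -> 1 <= r -> p ^ r < 5 ^ 5 ->
       euler_preperiod (p ^ r) = r.
Proof.
have s55 : euler_preperiod (5 ^ 5) = 4.
  have [_ _ _ E3 E4 _ _] := euler_zigzag_values.
  by apply: euler_preperiod_drop; rewrite ?E3 ?E4.
have small p r : prime p -> odd p -> 1 <= r -> p ^ r < 5 ^ 5 ->
    euler_preperiod (p ^ r) = r.
  case: r => // n pp op _ lt_pn; apply: euler_preperiod_prime_power => //.
  exact: prime_ndvd_euler_zigzag.
split; first by move=> /(_ 5 5 isT isT isT); rewrite s55.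
split; last by split.
split=> [|p r pp op r1 neq]; first by rewrite s55.
by rewrite leqNgt; apply/negP => /(small p r pp op r1).
Qed.
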